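(* With $\mathcal D$ the relative entropy rate $\mathcal D(\nu_k,\nu_k^0)=\sum_{s,u}\nu_k(s,u)\log\big(\phi_k(u\mid s)/\phi_k^0(u\mid s)\big)$, the optimization problem $$\min_{\nu,\gamma}\Big[\sum_{k=1}^K\mathcal D(\nu_k,\nu_k^0)+\frac{\kappa}{2}\sum_{k=1}^K\gamma_k^2\Big]$$ subject to, for $1\le k\le K$, $$\gamma_k=\langle\nu_k,\mathcal Y\rangle-r_k,\qquad \sum_{u'}\nu_k(s',u')=\sum_{s,u}\nu_{k-1}(s,u)\,T_{k-1}((s,u),s')\ \ (s'\in\mathsf S),$$ with $\nu_0=\nu_0^0$ given, is convex in $\{\nu_k,\gamma_k:1\le k\le K\}$. Furthermore, the second family of linear constraints is equivalent to the dynamics $$\nu_k=\nu_{k-1}P_{k-1},\qquad 1\le k\le K,$$ where $P_{k-1}(x,x')=T_{k-1}(x,s')\,\phi_k(u'\mid s')$ for $x\in\mathsf X$, $x'=(s',u')\in\mathsf X$.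
   Context: $\mathsf S$ and $\mathsf U$ are finite sets and $\mathsf X=\mathsf S\times\mathsf U$. Fix $K\ge1$, $\kappa>0$, $\mathcal Y:\mathsf X\to\mathbb R$, $r_1,\dots,r_K\in\mathbb R$, controlled transition matrices $T_k$ ($T_k(x,\cdot)$ a pmf on $\mathsf S$ for each $x\in\mathsf X$), an initial pmf $\nu_0^0$ on $\mathsf X$, and nominal randomized policies $\phi_k^0(u\mid s)$ (for each $s$, a pmf on $\mathsf U$), with nominal marginals $\nu_k^0$. The variables are pmfs $\nu_k$ on $\mathsf X$ (regarded as row vectors) and $\gamma_k\in\mathbb R$. Given $\nu_k$, $\phi_k$ is the randomized policy (conditional pmf) with $\nu_k(s,u)=\phi_k(u\mid s)\sum_{u'}\nu_k(s,u')$. $\langle\nu,\mathcal Y\rangle=\sum_x\nu(x)\mathcal Y(x)$. Usual conventions for relative entropy are used. *)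

(* Defs.v *)
From HB Require Import structures.
From mathcomp Require Import all_boot all_order all_algebra.
From mathcomp Require Import all_classical all_reals all_analysis.

Set Implicit Arguments.
Unset Strict Implicit.
Unset Printing Implicit Defensive.

Import Order.TTheory GRing.Theory Num.Theory.

Local Open Scope classical_set_scope.
Local Open Scope ring_scope.
Local Open Scope convex_scope.

(** Convex optimization problems *)

Section ConvexProblem.
Context {R : realType} {V : lmodType R}.

Definition affine_function (h : V -> R) : Prop :=
  forall (t : R) (x y : V),
    h (t *: x + (1 - t) *: y) = t * h x + (1 - t) * h y.

(* Extended-real-valued counterpart of [convex_function].  Since 0 * +oo = 0 in
   [\bar R], the endpoints t = 0 and t = 1 impose nothing. *)
Definition convex_efunction (D : set (convex_lmodType V))
    (f : convex_lmodType V -> \bar R) : Prop :=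
  forall (t : {i01 R}), {in D &, forall x y : convex_lmodType V,
    (f (x <| t |> y) <=
     t%:num%:E * f x + (1 - t%:num)%:E * f y)%E}.

(* Minimize [objective] over the points of [domain] that satisfy
   [lhs i v = rhs i v] for all i. *)
Record problem := Problem {
  domain : set V;
  objective : V -> \bar R;
  con_index : Type;
  lhs : con_index -> V -> R;
  rhs : con_index -> V -> R }.

Definition feasible (P : problem) : set (convex_lmodType V) :=
  [set v | domain P v /\ forall i, lhs (p := P) i v = rhs (p := P) i v].

(* Convexity of the feasible set follows from the first two conditions. *)
Definition convex_problem (P : problem) : Prop :=
  [/\ convex_set (domain P),
      (forall i, affine_function (lhs (p := P) i) /\
                 affine_function (rhs (p := P) i)),
      convex_set (feasible P)
    & convex_efunction (domain P) (objective P)].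

End ConvexProblem.
Arguments problem {R} V.

(** Controlled Markov model on X = S * U *)

Section Model.
Context {R : realType} {S U : finType}.

Definition is_pmf (A : finType) (p : A -> R) : Prop :=
  (forall a, 0 <= p a) /\ \sum_a p a = 1.

(* [phi s u] stands for phi(u | s). *)
Definition is_policy (phi : S -> U -> R) : Prop := forall s, is_pmf (phi s).

Definition state_marginal (nu : {ffun S * U -> R}) (s : S) : R :=
  \sum_(u : U) nu (s, u).

(* [phi] is a version of the conditional pmf of the input given the state; it is
   not unique at the states of zero probability. *)
Definition is_cond_policy (nu : {ffun S * U -> R}) (phi : S -> U -> R) : Prop :=
  is_policy phi /\ forall s u, nu (s, u) = phi s u * state_marginal nu s.

(* D(nu, nu0), where [phi] and [phi0] are the policies of nu and nu0.
   In [\bar R] one has p / 0 = +oo and lne +oo = +oo for p > 0, lne 0 = -oo,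
   and 0 * +oo = 0 * -oo = 0: these are the usual conventions. *)
Definition rel_entropy_rate (nu : {ffun S * U -> R})
    (phi phi0 : S -> U -> R) : \bar R :=
  (\sum_(s : S) \sum_(u : U)
     (nu (s, u))%:E * lne ((phi s u)%:E / (phi0 s u)%:E))%E.

Definition pairing (nu : {ffun S * U -> R}) (Y : S * U -> R) : R :=
  \sum_x nu x * Y x.

Definition flow (nu : {ffun S * U -> R}) (T : S * U -> S -> R) (s' : S) : R :=
  \sum_(s : S) \sum_(u : U) nu (s, u) * T (s, u) s'.

Definition kernel_of (T : S * U -> S -> R) (phi : S -> U -> R)
  : S * U -> S * U -> R := fun x x' => T x x'.1 * phi x'.1 x'.2.

(* the row vector nu P *)
Definition push_kernel (nu : {ffun S * U -> R}) (P : S * U -> S * U -> R)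
  : {ffun S * U -> R} := [ffun x' => \sum_x nu x * P x x'].

Section Problem.
Variable K : nat.

(* nu_1, ..., nu_K and gamma_1, ..., gamma_K; index i : 'I_K stands for
   k = i.+1. *)
Definition marginals : Type := {ffun 'I_K -> {ffun S * U -> R}}.
Definition variables : lmodType R := (marginals * {ffun 'I_K -> R})%type.

(* the full sequence nu_0 = nu00, nu_1, ..., nu_K *)
Definition traj (nu00 : {ffun S * U -> R}) (nu : marginals) (k : 'I_K.+1)
  : {ffun S * U -> R} := oapp nu nu00 (unlift ord0 k).

(* nu_{k-1} for k = i.+1 *)
Definition prev_marginal (nu00 : {ffun S * U -> R}) (nu : marginals) (i : 'I_K)
  : {ffun S * U -> R} := traj nu00 nu (widen_ord (leqnSn K) i).

(* Data indexed by nat carry the mathematical time index k.  [Phi k nu] is the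
   policy associated with the pmf nu at time k. *)
Definition control_problem (kappa : R) (Y : S * U -> R) (r : nat -> R)
    (T : nat -> S * U -> S -> R) (nu00 : {ffun S * U -> R})
    (phi0 : nat -> S -> U -> R)
    (Phi : nat -> {ffun S * U -> R} -> S -> U -> R) : problem variables :=
  @Problem R variables
    [set v : variables | forall i, is_pmf (v.1 i)]
    (fun v : variables => (\sum_(i < K)
                 rel_entropy_rate (v.1 i) (Phi i.+1 (v.1 i)) (phi0 i.+1)
               + (kappa / 2 * \sum_(i < K) v.2 i ^+ 2)%:E)%E)
    ('I_K + 'I_K * S)%type
    (fun c v => match c with
                | inl i => v.2 i
                | inr (i, s') => state_marginal (v.1 i) s'
                end)
    (fun c v => match c with
                | inl i => pairing (v.1 i) Y - r i.+1
                | inr (i, s') => flow (prev_marginal nu00 v.1 i) (T i) s'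
                end).

End Problem.
End Model.
Arguments variables R S U K : clear implicits.
Arguments marginals R S U K : clear implicits.

(* Main.v *)
Require Import Defs.
From mathcomp Require Import all_boot all_order all_algebra.
From mathcomp Require Import all_classical all_reals all_analysis.
From mathcomp Require Import ring lra.

(** Why the theorem is true.  Write m(s) for the state marginal of a pmf nu.
    As nu(s,u) = phi(u|s) m(s), the ratio phi / phi0 equals
    nu(s,u) / (m(s) phi0(u|s)) wherever nu(s,u) > 0, so that

      D(nu, nu0) = sum over (s,u) of nu(s,u) log (nu(s,u) / (m(s) phi0(u|s)))

    on pmfs ([rel_entropy_rateE]).  This removes phi, a nonlinear and not
    uniquely determined function of nu: each summand is now g(a, b) =
    a log (a / b) evaluated at two linear functions of nu.  The function g is
    jointly convex ([rel_ent_convex]), because by the inequality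
    log y <= y - 1 it is bounded below by the affine functions
    (a, b) |-> a log c + a - b c, c > 0 ([rel_ent_ge_tangent]), and it is their
    supremum: c = a / b gives equality when a, b > 0.  This description also
    covers the boundary, where g(0, b) = 0 and g(a, 0) = +oo.  Since g never
    takes the value -oo, extended-real sums of such terms, to which the convex
    quadratic penalty is added, remain convex ([proper_convex_sum]).  The
    constraints are affine in the variables, and pmfs form a convex set.

    For the dynamics, (mu P)(s,u) = phi(u|s) (mu T)(s).  Hence
    m = mu T gives nu = mu P by multiplying by phi(u|s), and nu = mu P gives
    m = mu T by summing over u ([dynamics_iff_marginal]). *)

Import Order.TTheory GRing.Theory Num.Theory.
Local Open Scope ring_scope.

(** * The convex function a log (a / b) *)

(** The summand of a relative entropy, with values in [\bar R] so that the
    conventions at a = 0 and at b = 0 < a are those of extended arithmetic. *)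
Definition rel_ent {R : realType} (a b : R) : \bar R :=
  (a%:E * lne (a%:E / b%:E))%E.

Lemma rel_ent0l (R : realType) (b : R) : rel_ent 0 b = 0%E.
Proof. by rewrite /rel_ent mul0e. Qed.

Lemma rel_ent0r (R : realType) (a : R) : 0 < a -> rel_ent a 0 = +oo%E.
Proof.
by move=> a0; rewrite /rel_ent inver eqxx gt0_muley ?lte_fin//= gt0_muley ?lte_fin.
Qed.

Lemma rel_ent_pos (R : realType) (a b : R) :
  0 < a -> 0 < b -> rel_ent a b = (a * ln (a / b))%:E.
Proof.
move=> a0 b0; rewrite /rel_ent inver gt_eqF// -EFinM lne_EFin ?divr_gt0//.
Qed.

(** The lower bound is the tangent plane of a log (a / b) along the ray
    a = c b; for a, b > 0 it follows from log y <= y - 1 at y = b c / a. *)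
Lemma rel_ent_ge_tangent (R : realType) (a b c : R) :
  0 <= a -> 0 <= b -> 0 < c ->
  ((a * ln c + a - b * c)%:E <= rel_ent a b)%E.
Proof.
move=> a_ge0 b_ge0 c0.
have [->|a0] := eqVneq a 0.
  by rewrite rel_ent0l lee_fin mul0r !add0r oppr_le0 mulr_ge0// ltW.
have {a_ge0} {}a0 : 0 < a by rewrite lt_neqAle eq_sym a0.
have [->|b0] := eqVneq b 0; first by rewrite rel_ent0r// leey.
have {b_ge0} {}b0 : 0 < b by rewrite lt_neqAle eq_sym b0.
rewrite rel_ent_pos// lee_fin.
have y0 : 0 < b * c / a by rewrite divr_gt0// mulr_gt0.
have : ln (1 + (b * c / a - 1)) <= b * c / a - 1.
  by apply: le_ln1Dx; rewrite ltrBrDl subrr.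
rewrite addrC subrK !ln_div ?posrE ?mulr_gt0// lnM ?posrE// => ln_le.
rewrite -(ler_pM2l a0) in ln_le.
have -> : b * c = a * (b * c / a) by rewrite mulrCA divff ?mulr1// gt_eqF.
lra.
Qed.

Lemma rel_ent_gtNy (R : realType) (a b : R) :
  0 <= a -> 0 <= b -> (-oo < rel_ent a b)%E.
Proof.
move=> a0 b0; apply: lt_le_trans (@rel_ent_ge_tangent _ _ _ 1 a0 b0 ltr01).
exact: ltNyr.
Qed.

(** Write (A, B) for the combined point.  The right member dominates the value
    at (A, B) of every tangent plane, so it suffices to recover the value at (A, B) as a supremum
    of tangent values.  The weights p and q need not sum to 1, because
    a log (a / b) is homogeneous of degree one. *)
Lemma rel_ent_convex (R : realType) (p q a b a' b' : R) :
  0 < p -> 0 < q -> 0 <= a -> 0 <= b -> 0 <= a' -> 0 <= b' ->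
  (rel_ent (p * a + q * a') (p * b + q * b') <=
   p%:E * rel_ent a b + q%:E * rel_ent a' b')%E.
Proof.
move=> p0 q0 a0 b0 a'0 b'0.
set A := p * a + q * a'; set B := p * b + q * b'.
have A_ge0 : 0 <= A by rewrite addr_ge0// mulr_ge0// ltW.
have B_ge0 : 0 <= B by rewrite addr_ge0// mulr_ge0// ltW.
have tangent c : 0 < c -> ((A * ln c + A - B * c)%:E <=
    p%:E * rel_ent a b + q%:E * rel_ent a' b')%E.
  move=> c0.
  have -> : A * ln c + A - B * c =
    p * (a * ln c + a - b * c) + q * (a' * ln c + a' - b' * c).
    by rewrite /A /B; ring.
  rewrite EFinD !EFinM; apply: leeD; apply: lee_wpmul2l;
    by [rewrite lee_fin ltW | exact: rel_ent_ge_tangent].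
have [A_eq0|A_neq0] := eqVneq A 0.
  have [a_eq0 a'_eq0] : a = 0 /\ a' = 0.
    move: (A_eq0); rewrite /A => /eqP; rewrite paddr_eq0;
      rewrite ?(mulr_ge0 (ltW p0)) ?(mulr_ge0 (ltW q0))//.
    by rewrite !mulf_eq0 (gt_eqF p0) (gt_eqF q0) /= => /andP[/eqP -> /eqP ->].
  by rewrite A_eq0 a_eq0 a'_eq0 !rel_ent0l !mule0 adde0.
have A0 : 0 < A by rewrite lt_neqAle eq_sym A_neq0.
have [B_eq0|B_neq0] := eqVneq B 0; last first.
  have B0 : 0 < B by rewrite lt_neqAle eq_sym B_neq0.
  (* the tangent plane that touches the graph at (A, B) *)
  rewrite rel_ent_pos//; apply: le_trans (tangent (A / B) _); last first.
    exact: divr_gt0.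
  by rewrite lee_fin -addrA mulrCA divff ?gt_eqF// mulr1 subrr addr0.
(* For B = 0 < A the tangent values A log c + A are unbounded: the choice
   c = exp (y / A) makes them exceed any y, so the right member is +oo. *)
rewrite B_eq0 in tangent *.
rewrite [leRHS](_ : _ = +oo%E) ?leey//; apply/eqyP => y _.
apply: le_trans (tangent (expR (y / A)) (expR_gt0 _)).
by rewrite lee_fin expRK mulrCA divff ?gt_eqF// mulr1 mul0r subr0 lerDl ltW.
Qed.

(** * Affine functions *)

Section AffineFunctions.
Context {R : realType} {V : lmodType R}.
Implicit Types f g : V -> R.

Lemma affine_cst (c : R) : affine_function (fun _ : V => c).
Proof. by move=> t x y; ring. Qed.

Lemma affine_add f g : affine_function f -> affine_function g ->
  affine_function (fun v => f v + g v).
Proof. by move=> f_aff g_aff t x y; rewrite f_aff g_aff; ring. Qed.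

Lemma affine_mulr f (c : R) : affine_function f ->
  affine_function (fun v => f v * c).
Proof. by move=> f_aff t x y; rewrite f_aff; ring. Qed.

Lemma affine_sum (I : finType) (F : I -> V -> R) :
  (forall i, affine_function (F i)) -> affine_function (fun v => \sum_i F i v).
Proof.
move=> F_aff t x y; rewrite !mulr_sumr -big_split.
by apply: eq_bigr => i _; exact: F_aff.
Qed.

End AffineFunctions.

(** * Extended-real-valued convex functions *)

Section ProperConvex.
Context {R : realType} {V : lmodType R}.
Implicit Types (D : set V) (f g : V -> \bar R).

(** Excluding the value -oo is what makes convexity stable under addition: it
    rules out the sums +oo + -oo, for which distributivity fails. *)
Definition proper_convex D f : Prop :=
  (forall x, D x -> (-oo < f x)%E) /\ convex_efunction D f.

Lemma eq_proper_convex D f g : convex_set D -> (forall x, D x -> f x = g x) ->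
  proper_convex D g -> proper_convex D f.
Proof.
move=> D_convex fg [g_gtNy g_convex]; split=> [x Dx|t x y Dx Dy].
  by rewrite fg// g_gtNy.
have Dxy := D_convex x y t Dx Dy.
by move: (Dx) (Dy) (Dxy); rewrite !inE => *; rewrite !fg//; exact: g_convex.
Qed.

Lemma proper_convex_cst0 D : proper_convex D (fun=> 0%E).
Proof. by split=> [x _|t x y _ _]; rewrite ?ltNy0// !mule0 adde0. Qed.

Lemma proper_convex_add D f g : proper_convex D f -> proper_convex D g ->
  proper_convex D (fun x => (f x + g x)%E).
Proof.
move=> [f_gtNy f_convex] [g_gtNy g_convex]; split=> [x Dx|t x y Dx Dy].
  by rewrite lteNye adde_eq_ninfty negb_or -!lteNye f_gtNy// g_gtNy.
have add_def z : z \in D -> (f z +? g z)%E.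
  by rewrite inE => Dz; apply: ltninfty_adde_def; rewrite inE/= ?f_gtNy ?g_gtNy.
rewrite !muleDr ?add_def// addeACA.
by apply: leeD; [exact: f_convex|exact: g_convex].
Qed.

Lemma proper_convex_sum D (I : finType) (F : I -> V -> \bar R) :
  (forall i, proper_convex D (F i)) ->
  proper_convex D (fun x => (\sum_i F i x)%E).
Proof.
move=> F_convex; elim: (index_enum I) => [|i s IHs].
  by under eq_fun do rewrite big_nil; exact: proper_convex_cst0.
by under eq_fun do rewrite big_cons; exact: proper_convex_add.
Qed.

(** Convexity of the square, quantitatively: for weights t and 1 - t the gap
    between the two members is c t (1 - t) (h x - h y)^2. *)
Lemma proper_convex_sqr D (c : R) (h : V -> R) : 0 <= c -> affine_function h ->
  proper_convex D (fun x => (c * h x ^+ 2)%:E).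
Proof.
move=> c0 h_aff; split=> [x _|t x y _ _]; first exact: ltNyr.
rewrite -!EFinM -EFinD lee_fin [h _]h_aff -subr_ge0.
rewrite [X in _ <= X](_ : _ =
    c * t%:num * (1 - t%:num) * (h x - h y) ^+ 2); last first.
  by rewrite /unstable.onem; ring.
by rewrite mulr_ge0 ?sqr_ge0// !mulr_ge0// subr_ge0.
Qed.

Lemma proper_convex_rel_ent D (h k : V -> R) :
  affine_function h -> affine_function k ->
  (forall x, D x -> 0 <= h x /\ 0 <= k x) ->
  proper_convex D (fun x => rel_ent (h x) (k x)).
Proof.
move=> h_aff k_aff hk_ge0; split=> [x /hk_ge0[]|t x y]; first exact: rel_ent_gtNy.
rewrite !inE => /hk_ge0[hx0 kx0] /hk_ge0[hy0 ky0].
(* The homogeneous inequality needs positive weights; at an end point the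
   average is one of the two points. *)
have [->|t_neq0] := eqVneq t 0%:i01.
  by rewrite conv0/= mul0e subr0 mul1e add0e.
have [->|t_neq1] := eqVneq t 1%:i01.
  by rewrite conv1/= subrr mul0e mul1e adde0.
rewrite [h _]h_aff [k _]k_aff; apply: rel_ent_convex => //.
  by rewrite lt_neqAle eq_sym t_neq0 /=.
by rewrite subr_gt0 lt_neqAle t_neq1 /=.
Qed.

End ProperConvex.

(** * Marginals and conditional policies *)

Section ConditionalPolicy.
Context {R : realType} {S U : finType}.
Implicit Types (nu : {ffun S * U -> R}) (phi : S -> U -> R).

(** Each summand is weighted by nu(s,u), so only pairs with nu(s,u) > 0 matter.
    There m(s) > 0 and the factor m(s) cancels in nu / (m phi0); if moreover
    phi0(u|s) = 0, both quotients are +oo. *)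
Lemma rel_entropy_rateE nu phi phi0 :
  is_pmf nu -> is_cond_policy nu phi ->
  rel_entropy_rate nu phi phi0 =
  (\sum_s \sum_u rel_ent (nu (s, u)) (state_marginal nu s * phi0 s u)%R)%E.
Proof.
move=> [nu_ge0 _] [_ nuE].
apply: eq_bigr => s _; apply: eq_bigr => u _; rewrite /rel_ent nuE.
have [->|m_neq0] := eqVneq (state_marginal nu s) 0.
  by rewrite mulr0 !mul0e.
have m_gt0 : 0 < state_marginal nu s.
  by rewrite lt_neqAle eq_sym m_neq0 sumr_ge0.
have [->|phi_neq0] := eqVneq (phi s u) 0; first by rewrite mul0r !mul0e.
have phi_gt0 : 0 < phi s u.
  rewrite lt_neqAle eq_sym phi_neq0/= -(pmulr_lge0 _ m_gt0).
  by rewrite -nuE.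
congr (_ * lne _)%E.
have [->|phi0_neq0] := eqVneq (phi0 s u) 0.
  by rewrite mulr0 inve0 !gt0_muley ?lte_fin ?mulr_gt0.
rewrite !inver mulf_eq0 (negPf phi0_neq0) (negPf m_neq0)/= -!EFinM.
by congr EFin; field; apply/andP.
Qed.

(** The next input is drawn from phi given the next state, so
    (mu P)(s,u) = phi(u|s) (mu T)(s).  The kernel depends on nu itself through
    phi, hence the second condition is a fixed-point equation, not a recursion
    defining nu. *)
Lemma dynamics_iff_marginal mu nu (T : S * U -> S -> R) phi :
  is_cond_policy nu phi ->
  (forall s, state_marginal nu s = flow mu T s) <->
  nu = push_kernel mu (kernel_of T phi).
Proof.
move=> [phi_pmf nuE].
have pushE s u : push_kernel mu (kernel_of T phi) (s, u) = phi s u * flow mu T s.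
  rewrite ffunE /flow pair_bigA mulr_sumr.
  by apply: eq_bigr => -[s' u'] _ /=; rewrite /kernel_of/=; ring.
split=> [marg|-> s].
  by apply/ffunP => -[s u]; rewrite pushE -marg nuE.
rewrite /state_marginal; under eq_bigr do rewrite pushE.
by rewrite -mulr_suml (phi_pmf s).2 mul1r.
Qed.

End ConditionalPolicy.

(** * The control problem *)

Section Variables.
Context {R : realType} {S U : finType} {K : nat}.
Local Notation V := (variables R S U K).

Lemma affine_marginal (i : 'I_K) (x : S * U) :
  affine_function (fun v : V => v.1 i x).
Proof. by move=> t v w; rewrite /= !ffunE. Qed.

Lemma affine_gamma (i : 'I_K) : affine_function (fun v : V => v.2 i).
Proof. by move=> t v w; rewrite /= !ffunE. Qed.

(** At the first step the previous marginal is the given initial pmf, which is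
    why the flow constraints are affine rather than linear. *)
Lemma affine_prev_marginal (nu00 : {ffun S * U -> R}) (i : 'I_K) (x : S * U) :
  affine_function (fun v : V => prev_marginal nu00 v.1 i x).
Proof.
rewrite /prev_marginal /traj; case: unliftP => [j _|_] /=.
  exact: affine_marginal.
exact: affine_cst.
Qed.

Lemma convex_set_pmf :
  convex_set [set v : V | forall i, is_pmf (v.1 i)]%classic.
Proof.
move=> v w t; rewrite !inE => v_pmf w_pmf i; split=> [x|].
  rewrite [_ x](affine_marginal i x t%:num v w).
  by rewrite addr_ge0 ?mulr_ge0 ?(v_pmf i).1 ?(w_pmf i).1// subr_ge0.
rewrite [LHS](affine_sum _ _ (affine_marginal i) t%:num v w).
by rewrite (v_pmf i).2 (w_pmf i).2 !mulr1 addrC subrK.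
Qed.

End Variables.

Lemma convex_set_feasible (R : realType) (V : lmodType R) (P : problem V) :
  convex_set (domain P) ->
  (forall i, affine_function (lhs (p := P) i) /\ affine_function (rhs (p := P) i)) ->
  convex_set (feasible P).
Proof.
move=> D_convex con_aff v w t; rewrite !inE => -[Dv v_con] [Dw w_con].
split=> [|i].
  by have := D_convex v w t; rewrite !inE; exact.
have [lhs_aff rhs_aff] := con_aff i.
by rewrite [LHS]lhs_aff [RHS]rhs_aff v_con w_con.
Qed.

Theorem proposition1p1 (R : realType) (S U : finType) (K : nat) (kappa : R)
    (Y : S * U -> R) (r : nat -> R) (T : nat -> S * U -> S -> R)
    (nu0 : nat -> {ffun S * U -> R}) (phi0 : nat -> S -> U -> R)
    (Phi : nat -> {ffun S * U -> R} -> S -> U -> R)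
    (K_ge1 : (1 <= K)%N)
    (kappa_gt0 : 0 < kappa)
    (T_pmf : forall k x, (k < K)%N -> is_pmf (T k x))
    (nu00_pmf : is_pmf (nu0 0%N))
    (phi0_policy : forall k, (1 <= k <= K)%N -> is_policy (phi0 k))
    (nu0_nominal : forall k, (1 <= k <= K)%N ->
       nu0 k = push_kernel (nu0 k.-1) (kernel_of (T k.-1) (phi0 k)))
    (Phi_cond : forall k (nu : {ffun S * U -> R}),
       (1 <= k <= K)%N -> is_pmf nu -> is_cond_policy nu (Phi k nu)) :
  convex_problem (control_problem K kappa Y r T (nu0 0%N) phi0 Phi) /\
  forall nu : marginals R S U K, (forall i, is_pmf (nu i)) ->
    ((forall (i : 'I_K) (s' : S),
        state_marginal (nu i) s' = flow (prev_marginal (nu0 0%N) nu i) (T i) s')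
     <->
     (forall i : 'I_K,
        nu i = push_kernel (prev_marginal (nu0 0%N) nu i)
                    (kernel_of (T i) (Phi i.+1 (nu i))))).
Proof.
have cond_policy (nu : marginals R S U K) (i : 'I_K) :
    (forall i, is_pmf (nu i)) -> is_cond_policy (nu i) (Phi i.+1 (nu i)).
  by move=> nu_pmf; apply: Phi_cond; [exact: ltn_ord|exact: nu_pmf].
split; last first.
  move=> nu nu_pmf.
  have dynE i := dynamics_iff_marginal
    (prev_marginal (nu0 0%N) nu i) _ (T i) _ (cond_policy nu i nu_pmf).
  by split=> dyn i; [apply/dynE => s; exact: dyn|move/dynE: (dyn i); exact].
have aff_marg (i : 'I_K) s :
    affine_function (fun v : variables R S U K => state_marginal (v.1 i) s).
  by apply: affine_sum => u; exact: affine_marginal.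
set P := control_problem _ _ _ _ _ _ _ _.
have con_aff c : affine_function (lhs (p := P) c) /\
    affine_function (rhs (p := P) c).
  case: c => [i|[i s]]; split=> /=.
  - exact: affine_gamma.
  - apply: affine_add; last exact: affine_cst.
    by apply: affine_sum => x; apply: affine_mulr; exact: affine_marginal.
  - exact: aff_marg.
  - apply: affine_sum => s'; apply: affine_sum => u'; apply: affine_mulr.
    exact: affine_prev_marginal.
split.
- exact: convex_set_pmf.
- exact: con_aff.
- by apply: convex_set_feasible; [exact: convex_set_pmf|exact: con_aff].
set D := domain _.
suff [_] : proper_convex D
  (objective P) by [].
apply: (@eq_proper_convex _ _ _ _ (fun v : variables R S U K =>
  (\sum_(i < K) \sum_s \sum_u rel_ent (v.1 i (s, u))
     (state_marginal (v.1 i) s * phi0 i.+1 s u)%R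
   + \sum_(i < K) (kappa / 2 * v.2 i ^+ 2)%:E)%E)).
- exact: convex_set_pmf.
- move=> v v_pmf; rewrite /= sumEFin mulr_sumr; congr (_ + _)%E.
  by apply: eq_bigr => i _; apply: rel_entropy_rateE => //; exact: cond_policy.
apply: proper_convex_add; apply: proper_convex_sum => i; last first.
  by apply: proper_convex_sqr; [rewrite divr_ge0// ltW|exact: affine_gamma].
apply: proper_convex_sum => s; apply: proper_convex_sum => u.
apply: proper_convex_rel_ent => [||v v_pmf].
- exact: affine_marginal.
- by apply: affine_mulr; exact: aff_marg.
- have [nu_ge0 _] := v_pmf i; split=> //.
  rewrite mulr_ge0//; first by rewrite sumr_ge0.
  by have [] := phi0_policy i.+1 (ltn_ord i) s.
Qed.
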